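(* (Rothaus-Orlicz inequality.) Let $F$ be $C^2$ on $(0,+\infty)$ with $F(1)=0$ and such that: (i) $F$ is concave, non-decreasing, and goes to infinity at $+\infty$; (ii) $uF'(u)$ is bounded by a constant $K(F)$ on $(0,+\infty)$. Then there is a constant $C_{Rot}(F)$, depending only on $F$, such that for any probability measure $\mu$ and any bounded function $f$, $$\int f^2F\left(\frac{f^2}{\mu(f^2)}\right)d\mu\le\int\tilde f^2F\left(\frac{\tilde f^2}{\mu(\tilde f^2)}\right)d\mu+C_{Rot}(F)\,\|\tilde f\|_2^2,$$ where $\tilde f=f-\int f\,d\mu$.
   Context: $\mu(g)=\int g\,d\mu$ and $\|\cdot\|_2$ is the $L^2(\mu)$ norm. The integrands $g^2F(g^2/\mu(g^2))$ are taken to be $0$ at points where $g=0$. *)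

(* Defs.v *)
From HB Require Import structures.
From mathcomp Require Import all_boot all_order all_algebra.
From mathcomp Require Import all_classical all_reals all_analysis.

Set Implicit Arguments.
Unset Strict Implicit.
Unset Printing Implicit Defensive.

Import Order.TTheory GRing.Theory Num.Theory.
Import numFieldNormedType.Exports.

Local Open Scope classical_set_scope.
Local Open Scope ring_scope.

(* A function on (0, +oo) is represented by a total F : R -> R whose values on
   (-oo, 0] are arbitrary: every condition below is local to (0, +oo). *)
Definition C2_pos (R : realType) (F : R -> R) : Prop :=
  forall u : R, 0 < u ->
    [/\ derivable F u 1, derivable (F^`())%classic u 1 & {for u, continuous (F^`(2))%classic}].

Definition concave_pos (R : realType) (F : R -> R) : Prop :=
  @convex_function R R^o `]0, +oo[%classic (\- F).

Definition nondecreasing_pos (R : realType) (F : R -> R) : Prop :=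
  {in `]0, +oo[ &, {homo F : x y / x <= y}}.

(* The integrand is 0 wherever g = 0, whatever the value F 0, because of the
   factor g ^+ 2. If the integral of g ^+ 2 vanishes then g = 0 almost
   everywhere, so the convention x / 0 = 0 plays no role either. *)
Definition orlicz_integral d (T : measurableType d) (R : realType)
    (F : R -> R) (mu : probability T R) (g : T -> R) : \bar R :=
  (\int[mu]_x
     (g x ^+ 2 * F (g x ^+ 2 / (\int[mu]_y (g y ^+ 2))%R))%:E)%E.

Definition centered d (T : measurableType d) (R : realType)
    (mu : probability T R) (f : T -> R) : T -> R :=
  fun x => f x - \int[mu]_y f y.

(* Main.v *)
Require Import Defs.
From HB Require Import structures.
From mathcomp Require Import all_boot all_order all_algebra.
From mathcomp Require Import all_classical all_reals all_analysis.
From mathcomp Require Import measurable_realfun ring lra.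

Set Implicit Arguments.
Unset Strict Implicit.
Unset Printing Implicit Defensive.

Import Order.TTheory GRing.Theory Num.Theory.
Import numFieldNormedType.Exports.

Local Open Scope classical_set_scope.
Local Open Scope ring_scope.

(** Write [f = a + h] with [a] the mean of [f] and [h] the centred function, and
    put [v = mu(h^2)], so that [mu(f^2) = a^2 + v]. The inequality follows by
    integrating a pointwise one ([pointwise_ineq]):

      [(a+h)^2 F((a+h)^2/(a^2+v)) <= h^2 F(h^2/v) + 100 K (h^2 + v) + 2 L a h],

    where [K] bounds [u F'(u)] and [L = F'(1)]; the last term has integral zero
    because [h] is centred, and the one before it contributes [200 K v].

    Concavity and the bound on [u F'(u)] enter only through two consequences:
    the tangent bound [F u <= L (u - 1)] and the growth bound
    [F w <= F u + K (w/u - 1)] for [u <= w], which expresses that [F] grows at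
    most logarithmically. The growth bound also gives [u F(u) >= -K] for
    [u >= 0], hence [h^2 F(h^2/v) >= -K v].

    By homogeneity assume [a^2 + v = 1], and write [p], [x] for [a], [h].
    - If [|x|] is at least 1/4, then [|p + x| <= 5 |x|], so that [F((p+x)^2)]
      exceeds [F(x^2)] by at most a constant, while [(p+x)^2 - x^2] is
      [O(|x|)] and a positive [F((p+x)^2)] is also [O(|x|)]; replacing
      [F(x^2)] by [F(x^2/v)] is free since [v <= 1] and [F] is non-decreasing
      ([pointwise_far]).
    - If [|x|] is at most 1/4, the tangent bound gives
      [y^2 F(y^2) <= L y^2 (y^2 - 1)] with [y = p + x]. As
      [y^2 - 1 = 2 p x + x^2 - v], the right-hand side is [2 L p x] up to
      [O(x^2 + v)]. Here [x^2 F(x^2)] may be far below [- x^2], and it is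
      essential to keep [F(x^2/v)] on the other side and to bound
      [x^2 F(x^2/v)] below by [-K v] ([pointwise_near]).

    When [v = 0] the function [f] is almost everywhere constant and both
    Orlicz integrals vanish because [F 1 = 0]. *)

(** * Tangent and growth bounds for concave functions *)

(** Concavity bounds the difference quotients of [F] in the direction [w - u]
    from below by [F w - F u]; let the step tend to zero from the right. *)
Lemma concave_le_tangent (R : realType) (F : R -> R) (u w : R) :
  concave_pos F -> 0 < u -> 0 < w -> derivable F u 1 ->
  F w <= F u + (F^`())%classic u * (w - u).
Proof.
move=> Fc u0 w0 dF.
have dFu : differentiable F u by exact/derivable1_diffP.
have dFw : derivable F u (w - u) by exact: diff_derivable.
have DE : 'D_(w - u) F u = (F^`())%classic u * (w - u).
  rewrite derive1E !deriveE//.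
  by rewrite -[in LHS](mulr1 (w - u)) linearZ /= mulrC.
rewrite -lerBlDl -DE.
have cvgr : h^-1 *: (F (h *: (w - u) + u) - F u) @[h --> 0^'+] --> 'D_(w - u) F u.
  exact: cvg_dnbhs_at_right dFw.
rewrite -(cvg_lim _ cvgr)//.
apply: limr_ge; first by apply/cvg_ex; exists ('D_(w - u) F u).
near=> t.
have t0 : 0 < t by near: t; exact: nbhs_right_gt.
have t1 : t <= 1 by near: t; exact: nbhs_right_le.
have cvx : - F (t * w + (1 - t) * u) <= t * - F w + (1 - t) * - F u.
  by apply: (Fc (Itv01 (ltW t0) t1)); rewrite inE/= in_itv/= andbT.
rewrite /GRing.scale/= mulrC ler_pdivlMr//.
have -> : t * (w - u) + u = t * w + (1 - t) * u by ring.
lra.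
Unshelve. all: by end_near.
Qed.

(** The tangent bound at [u]. When [K] bounds [u F'(u)] at every point, integrating
    [F'] yields the stronger [F w <= F u + K log (w/u)], but the present form
    suffices below and keeps logarithms out of the argument. *)
Lemma concave_growth (R : realType) (F : R -> R) (K u w : R) :
  concave_pos F -> 0 < u -> u <= w -> derivable F u 1 ->
  u * (F^`())%classic u <= K ->
  F w <= F u + K * (w / u - 1).
Proof.
move=> Fc u0 uw dF FK; have w0 := lt_le_trans u0 uw.
apply: le_trans (concave_le_tangent Fc u0 w0 dF) _.
rewrite lerD2l.
have -> : (F^`())%classic u * (w - u) = u * (F^`())%classic u * (w / u - 1).
  by field; rewrite gt_eqF.
by rewrite ler_wpM2r// subr_ge0 ler_pdivlMr// mul1r.
Qed.
(** * The pointwise inequality *)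

Section pointwise.
Variables (R : realType) (F : R -> R) (K L : R).
Hypothesis F1 : F 1 = 0.
Hypothesis Fnd : nondecreasing_pos F.
Hypothesis F_tangent : forall u, 0 < u -> F u <= L * (u - 1).
Hypothesis F_growth : forall u w, 0 < u -> u <= w -> F w <= F u + K * (w / u - 1).
Hypothesis LK : `|L| <= K.

Let K_ge0 : 0 <= K. Proof. exact: le_trans LK. Qed.

Let F_homo u w : 0 < u -> u <= w -> F u <= F w.
Proof. by move=> u0 uw; apply: Fnd; rewrite ?in_itv/= ?andbT// (lt_le_trans u0). Qed.

(** For [u <= 1] apply the growth bound between [u] and [1], where [F]
    vanishes. *)
Lemma mulF_ge u : 0 <= u -> - K <= u * F u.
Proof.
rewrite le_eqVlt => /predU1P[<-|u0]; first by rewrite mul0r oppr_le0.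
have [u1|/ltW u1] := leP 1 u.
  rewrite (@le_trans _ _ 0) ?oppr_le0// mulr_ge0 ?(ltW u0)// -F1.
  exact: F_homo.
have := F_growth u0 u1; rewrite F1 -subr_le0 => FK.
rewrite -subr_ge0.
have -> : u * F u - - K = u * (F u + K * (1 / u - 1)) + K * u.
  by field; rewrite gt_eqF.
rewrite addr_ge0 ?mulr_ge0 ?(ltW u0)//; lra.
Qed.

Lemma mulF_rescaled_ge u v : 0 < v -> 0 <= u -> - (K * v) <= u * F (u / v).
Proof.
move=> v0 u0; have := mulF_ge (divr_ge0 u0 (ltW v0)).
rewrite -(ler_pM2r v0) => /le_trans; rewrite mulNr; apply.
by rewrite mulrAC divfK// gt_eqF.
Qed.

(** Using the growth bound from [1] to [y^2] directly would only give a quadratic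
    bound; going through the intermediate point [y] makes it linear. *)
Lemma F_sqr_le_linear y : 1 <= y -> F (y ^+ 2) <= 2 * K * y.
Proof.
move=> y1; have y0 : 0 < y by exact: lt_le_trans y1.
have yy : y <= y ^+ 2 by rewrite expr2 ler_pMl.
have := F_growth y0 yy; have := F_growth ltr01 y1.
rewrite F1 divr1 expr2 mulfK ?gt_eqF//; have := K_ge0; lra.
Qed.

(** Here [x^2] dominates everything of order [|x|] or [1], so no linear term is
    needed on the right. If [y = p + x] satisfies [y^2 <= 1], the left-hand side
    is non-positive; otherwise [F(y^2) >= 0] and
    [y^2 F(y^2) - x^2 F(x^2)] splits as
    [x^2 (F(y^2) - F(x^2)) + (y^2 - x^2) F(y^2)]. *)
Lemma pointwise_far p x v : p ^+ 2 + v = 1 -> 0 < v -> 1 / 4 <= `|x| ->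
  (p + x) ^+ 2 * F ((p + x) ^+ 2) <=
    x ^+ 2 * F (x ^+ 2 / v) + 92 * K * (x ^+ 2 + v).
Proof.
move=> pv v0 x4; set y := p + x.
have x2E : x ^+ 2 = `|x| ^+ 2 by rewrite real_normK ?num_real.
have x20 : 0 < x ^+ 2 by rewrite x2E; nra.
have [y1|y1] := leP (y ^+ 2) 1.
  have yF : y ^+ 2 * F (y ^+ 2) <= 0.
    have [->|y0] := eqVneq (y ^+ 2) 0; first by rewrite mul0r.
    rewrite mulr_ge0_le0 ?sqr_ge0// -F1 F_homo// lt_neqAle eq_sym y0 sqr_ge0//.
  have := mulF_rescaled_ge v0 (ltW x20).
  have : 0 <= K * v by rewrite mulr_ge0// ltW.
  have : 0 <= K * x ^+ 2 by rewrite mulr_ge0// ltW.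
  lra.
have p1 : `|p| <= 1.
  by rewrite -(@ler_pXn2r _ 2) ?nnegrE// expr1n real_normK ?num_real//; lra.
have x0 : 0 <= `|x| by [].
have yx : `|y| <= 5 * `|x| by apply: le_trans (ler_normD _ _) _; lra.
have y2E : y ^+ 2 = `|y| ^+ 2 by rewrite real_normK ?num_real.
have ny1 : 1 <= `|y|.
  by rewrite -(@ler_pXn2r _ 2) ?nnegrE// expr1n -y2E ltW.
have Fy0 : 0 <= F (y ^+ 2) by rewrite -F1 F_homo// ltW.
have Fyx : F (y ^+ 2) <= 10 * K * `|x|.
  rewrite y2E; apply: le_trans (F_sqr_le_linear ny1) _.
  have := ler_wpM2l K_ge0 yx; lra.
have Fyx2 : F (y ^+ 2) <= F (x ^+ 2) + 24 * K.
  have y25 : y ^+ 2 <= 25 * x ^+ 2 by rewrite y2E x2E; nra.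
  apply: le_trans (F_homo _ y25) _; first by rewrite (lt_trans ltr01).
  have x25 : x ^+ 2 <= 25 * x ^+ 2 by lra.
  by apply: le_trans (F_growth x20 x25) _; rewrite mulfK ?gt_eqF//; lra.
have Fx : F (x ^+ 2) <= F (x ^+ 2 / v).
  apply: F_homo => //; rewrite ler_pdivlMr// ler_piMr ?(ltW x20)//.
  by have := sqr_ge0 p; lra.
have yxd : y ^+ 2 - x ^+ 2 <= 6 * `|x|.
  have : p * x <= `|x|.
    by rewrite (le_trans (ler_norm _))// normrM ler_piMl.
  have := sqr_ge0 x; rewrite /y; lra.
have xF : x ^+ 2 * (F (y ^+ 2) - 24 * K) <= x ^+ 2 * F (x ^+ 2 / v).
  by rewrite ler_pM2l//; lra.
have dF : (y ^+ 2 - x ^+ 2) * F (y ^+ 2) <= 60 * K * x ^+ 2.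
  apply: (@le_trans _ _ (6 * `|x| * F (y ^+ 2))); first by rewrite ler_wpM2r.
  by have := ler_wpM2l x0 Fyx; rewrite x2E; lra.
have : 0 <= K * v by rewrite mulr_ge0// ltW.
have : 0 <= K * x ^+ 2 by rewrite mulr_ge0// ltW.
lra.
Qed.

(** The linear term [2 L p x] is the first-order part of [L y^2 (y^2 - 1)] at
    [y = p + x]; it is not [O(x^2 + v)] when [|x|] is small and [p] is close to
    [1] or [-1], but it disappears on integration. *)
Lemma pointwise_near p x v : p ^+ 2 + v = 1 -> 0 < v -> `|x| <= 1 / 4 ->
  (p + x) ^+ 2 * F ((p + x) ^+ 2) <=
    x ^+ 2 * F (x ^+ 2 / v) + 20 * K * (x ^+ 2 + v) + 2 * L * (p * x).
Proof.
move=> pv v0 x4; set y := p + x.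
have p2 := sqr_ge0 p; have x2 := sqr_ge0 x.
have x16 : x ^+ 2 <= 1 / 16.
  by rewrite -real_normK ?num_real//; have := normr_ge0 x; nra.
have yF : y ^+ 2 * F (y ^+ 2) <= L * (y ^+ 2 * (y ^+ 2 - 1)).
  have [->|y0] := eqVneq (y ^+ 2) 0; first by rewrite !mul0r mulr0.
  rewrite mulrCA ler_wpM2l ?sqr_ge0// F_tangent//.
  by rewrite lt_neqAle eq_sym y0 sqr_ge0.
have xF := mulF_rescaled_ge v0 x2.
have yE : y ^+ 2 * (y ^+ 2 - 1) =
    2 * (p * x) + x ^+ 2 - v + (2 * (p * x) + x ^+ 2 - v) ^+ 2.
  by rewrite /y (_ : v = 1 - p ^+ 2); [ring | lra].
have eE : `|x ^+ 2 - v + (2 * (p * x) + x ^+ 2 - v) ^+ 2| <= 15 * x ^+ 2 + 4 * v.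
  have px : (p * x) ^+ 2 <= x ^+ 2 by rewrite exprMn; nra.
  have v1 : v <= 1 by lra.
  have s0 : 0 <= (2 * (p * x) + x ^+ 2 - v) ^+ 2 by exact: sqr_ge0.
  (* [(a + b + c)^2 <= 3 (a^2 + b^2 + c^2)], as a sum of squares *)
  have s1 : (2 * (p * x) + x ^+ 2 - v) ^+ 2 <=
      3 * (4 * (p * x) ^+ 2 + (x ^+ 2) ^+ 2 + v ^+ 2).
    rewrite -subr_ge0 (_ : _ - _ = (2 * (p * x) - x ^+ 2) ^+ 2 +
      (2 * (p * x) + v) ^+ 2 + (x ^+ 2 + v) ^+ 2); last by ring.
    by rewrite !addr_ge0 ?sqr_ge0.
  have x4' : (x ^+ 2) ^+ 2 <= x ^+ 2 / 16 by rewrite expr2; nra.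
  have v2 : v ^+ 2 <= v by rewrite expr2; nra.
  rewrite ler_norml; lra.
have LE : L * (x ^+ 2 - v + (2 * (p * x) + x ^+ 2 - v) ^+ 2) <=
    K * (15 * x ^+ 2 + 4 * v).
  by rewrite (le_trans (ler_norm _))// normrM ler_pM.
have : 0 <= K * v by rewrite mulr_ge0// ltW.
have : 0 <= K * x ^+ 2 by rewrite mulr_ge0// ltW.
rewrite yE in yF.
move: yF LE; set e := (2 * (p * x) + x ^+ 2 - v) ^+ 2; lra.
Qed.

(** Homogeneity: dividing [a] and [h] by [s], the square root of [a^2 + v],
    reduces to the case [a^2 + v = 1]. In the far case the linear term, absent
    from [pointwise_far], is absorbed by [x^2]. *)
Lemma pointwise_ineq a h v : 0 < v ->
  (a + h) ^+ 2 * F ((a + h) ^+ 2 / (a ^+ 2 + v)) <=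
    h ^+ 2 * F (h ^+ 2 / v) + 100 * K * (h ^+ 2 + v) + 2 * L * a * h.
Proof.
move=> v0; set m := a ^+ 2 + v.
have m0 : 0 < m by rewrite ltr_wpDl ?sqr_ge0.
pose s := Num.sqrt m; have s0 : 0 < s by rewrite sqrtr_gt0.
have sN : s != 0 by rewrite gt_eqF.
have s2 : m = s ^+ 2 by rewrite sqr_sqrtr// ltW.
have pv : (a / s) ^+ 2 + v / m = 1.
  by rewrite expr_div_n -s2 -mulrDl divff// gt_eqF.
have vm : 0 < v / m by exact: divr_gt0.
have K0 := K_ge0.
have normalised : (a / s + h / s) ^+ 2 * F ((a / s + h / s) ^+ 2) <=
    (h / s) ^+ 2 * F ((h / s) ^+ 2 / (v / m)) +
    100 * K * ((h / s) ^+ 2 + v / m) + 2 * L * (a / s * (h / s)).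
  have c0 : 0 <= K * ((h / s) ^+ 2 + v / m).
    by rewrite mulr_ge0// addr_ge0 ?sqr_ge0// ltW.
  have [x4|/ltW x4] := leP `|h / s| (1 / 4).
    by apply: le_trans (pointwise_near pv vm x4) _; lra.
  have p1 : `|a / s| <= 1.
    by rewrite -(@ler_pXn2r _ 2) ?nnegrE// expr1n real_normK ?num_real//; lra.
  apply: le_trans (pointwise_far pv vm x4) _.
  have x0 : 0 <= `|h / s| by [].
  have x2E : (h / s) ^+ 2 = `|h / s| ^+ 2 by rewrite real_normK ?num_real.
  have px : `|a / s * (h / s)| <= 4 * (h / s) ^+ 2.
    rewrite normrM x2E; nra.
  have : `|L * (a / s * (h / s))| <= K * (4 * (h / s) ^+ 2).
    by rewrite normrM ler_pM.
  have : 0 <= K * (v / m) by rewrite mulr_ge0// ltW.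
  by rewrite ler_norml; lra.
have mN : m != 0 by rewrite gt_eqF.
have vN : v != 0 by rewrite gt_eqF.
have rescale x : m * (x / s) ^+ 2 = x ^+ 2.
  by rewrite expr_div_n -s2 mulrC divfK.
have := ler_wpM2l (ltW m0) normalised.
rewrite -mulrDl !mulrDr.
have -> : (h / s) ^+ 2 / (v / m) = h ^+ 2 / v.
  by rewrite expr_div_n -s2; field; rewrite vN mN.
have -> : ((a + h) / s) ^+ 2 = (a + h) ^+ 2 / m by rewrite expr_div_n -s2.
have -> : m * ((a + h) ^+ 2 / m * F ((a + h) ^+ 2 / m)) =
    (a + h) ^+ 2 * F ((a + h) ^+ 2 / m) by rewrite mulrA [m * _]mulrC divfK.
have -> : m * ((h / s) ^+ 2 * F (h ^+ 2 / v)) = h ^+ 2 * F (h ^+ 2 / v).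
  by rewrite mulrA rescale.
have -> : m * (100 * K * (h / s) ^+ 2) = 100 * K * h ^+ 2.
  by rewrite mulrCA rescale.
have -> : m * (100 * K * (v / m)) = 100 * K * v by field.
have -> : m * (2 * L * (a / s * (h / s))) = 2 * L * a * h.
  by rewrite s2; field.
by [].
Qed.
End pointwise.
(** * Measurability and integrability *)

(** [F] is continuous only on the open half-line, but its argument here lies in
    the closed one, and a single point does not affect measurability. The case
    [c = 0] covers functions whose square has integral zero. *)
Lemma measurable_mulF (R : realType) (F : R -> R) d (T : measurableType d)
    (g : T -> R) (c : R) :
  C2_pos F -> 0 <= c -> measurable_fun setT g ->
  measurable_fun setT (fun x => g x ^+ 2 * F (g x ^+ 2 / c)).
Proof.
move=> FC2 c0 mg.
have mF : measurable_fun (`[0, +oo[%classic : set R) F.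
  rewrite (_ : `[0, +oo[%classic = [set (0 : R)] `|` `]0, +oo[%classic); last first.
    by rewrite setU1itv.
  apply/measurable_funU => //; split; first exact: measurable_fun_set1.
  apply: open_continuous_measurable_fun; first exact: interval_open.
  move=> u; rewrite inE/= in_itv/= andbT => u0.
  have [dF _ _] := FC2 u u0.
  by apply: differentiable_continuous; exact/derivable1_diffP.
apply: measurable_funM; first exact: measurable_funX.
apply: (measurable_comp _ _ mF) => //.
  by move=> _ [x _ <-]; rewrite /= in_itv/= andbT divr_ge0// sqr_ge0.
by apply: measurable_funM => //; exact: measurable_funX.
Qed.

Lemma bounded_integrable (R : realType) d (T : measurableType d)
    (mu : probability T R) (g : T -> R) (M : R) :
  measurable_fun setT g -> (forall x, `|g x| <= M) ->
  mu.-integrable setT (EFin \o g).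
Proof.
move=> mg gM; apply: measurable_bounded_integrable => //.
  by rewrite (le_lt_trans (probability_le1 mu measurableT)) ?ltry.
by exists M; split; [exact: num_real|move=> N MN x _; exact: le_trans (gM x) (ltW MN)].
Qed.

Lemma Lnorm2_sqr (R : realType) d (T : measurableType d)
    (mu : {measure set T -> \bar R}) (h : T -> R) :
  (('N[mu]_2%:E[EFin \o h]) ^+ 2 = \int[mu]_x (h x ^+ 2)%:E)%E.
Proof.
have <- : (('N[mu]_2%:E[EFin \o h]) `^ 2 = ('N[mu]_2%:E[EFin \o h]) ^+ 2)%E.
  have := Lnorm_ge0 mu 2%:E (EFin \o h).
  case: ('N[mu]_2%:E[EFin \o h])%E => [r|_|//].
    by rewrite lee_fin => r0; rewrite poweR_EFin powR_mulrn// EFin_expe.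
  by rewrite poweRyr ?pnatr_eq0// expeS expe1 mulyy.
rewrite poweR_Lnorm//.
apply: eq_integral => x _ /=.
by rewrite powR_mulrn// real_normK ?num_real.
Qed.

(** If [g] is almost everywhere [a != 0], then [g^2 / mu(g^2)] is almost
    everywhere [1], a zero of [F]; if [a = 0] the factor [g^2] vanishes. *)
Lemma orlicz_integral_ae_cst (R : realType) (F : R -> R) d (T : measurableType d)
    (mu : probability T R) (g : T -> R) (a : R) :
  C2_pos F -> F 1 = 0 -> measurable_fun setT g ->
  {ae mu, forall x, g x = a} -> orlicz_integral F mu g = 0%E.
Proof.
move=> FC2 F1 mg ga.
have g2 : (\int[mu]_x (g x ^+ 2))%R = a ^+ 2.
  rewrite /Rintegral (ae_eq_integral (cst (a ^+ 2)%:E)) ?integral_cst//.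
  - by rewrite /= probability_setT mule1.
  - by apply/measurable_EFinP; exact: measurable_funX.
  - by apply: filterS ga => x -> _.
rewrite /orlicz_integral g2 (ae_eq_integral (cst 0%E)) ?integral0//.
  by apply/measurable_EFinP; apply: measurable_mulF => //; exact: sqr_ge0.
apply: filterS ga => x -> _ /=; congr EFin.
have [->|a0] := eqVneq a 0; first by rewrite expr0n mul0r.
by rewrite divff ?F1 ?mulr0// sqrf_eq0.
Qed.

Lemma ae_eq0_of_sqr (R : realType) d (T : measurableType d)
    (mu : probability T R) (h : T -> R) :
  measurable_fun setT h -> (\int[mu]_x (h x ^+ 2)%:E = 0)%E ->
  {ae mu, forall x, h x = 0}.
Proof.
move=> mh h0.
have mh2 : measurable_fun setT (fun x => (h x ^+ 2)%:E).
  by apply/measurable_EFinP; exact: measurable_funX.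
have /(ae_eq_integral_abs mu measurableT mh2) : (\int[mu]_x `|(h x ^+ 2)%:E| = 0)%E.
  by rewrite -h0; apply: eq_integral => x _; rewrite gee0_abs// lee_fin sqr_ge0.
apply: filterS => x /(_ I) /= [/eqP]; rewrite sqrf_eq0 => /eqP //.
Qed.
(** * Integration of the pointwise inequality *)

Section integration.
Variables (R : realType) (F : R -> R) (K L : R).
Hypothesis FC2 : C2_pos F.
Hypothesis F1 : F 1 = 0.
Hypothesis Fnd : nondecreasing_pos F.
Hypothesis F_tangent : forall u, 0 < u -> F u <= L * (u - 1).
Hypothesis F_growth : forall u w, 0 < u -> u <= w -> F w <= F u + K * (w / u - 1).
Hypothesis LK : `|L| <= K.
Variables (d : measure_display) (T : measurableType d) (mu : probability T R).

(** The integrand is [c u F(u)] with [u = g^2/c] ranging over a bounded subset of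
    [0, +oo[, on which [-K <= u F(u) <= K u^2 + K]. *)
Lemma integrable_orlicz (g : T -> R) (M c : R) :
  measurable_fun setT g -> (forall x, `|g x| <= M) -> 0 < c ->
  mu.-integrable setT (fun x => (g x ^+ 2 * F (g x ^+ 2 / c))%:E).
Proof.
move=> mg gM c0.
have K0 : 0 <= K by exact: le_trans LK.
apply: (@bounded_integrable _ _ _ mu _ (c * (K * (1 + (M ^+ 2 / c) ^+ 2)))).
  by apply: measurable_mulF => //; exact: ltW.
move=> x; set u := g x ^+ 2 / c.
have -> : g x ^+ 2 = c * u by rewrite mulrC divfK ?gt_eqF.
rewrite -mulrA normrM (gtr0_norm c0) ler_pM2l//.
have u0 : 0 <= u by rewrite divr_ge0 ?sqr_ge0 ?ltW.
have uM : u ^+ 2 <= (M ^+ 2 / c) ^+ 2.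
  have M0 : 0 <= M by exact: le_trans (gM x).
  rewrite lerXn2r ?nnegrE ?divr_ge0 ?sqr_ge0 ?(ltW c0)//.
  rewrite ler_pM2r ?invr_gt0// -(real_normK (num_real (g x))).
  by rewrite lerXn2r ?nnegrE.
have uFM : K * (1 + u ^+ 2) <= K * (1 + (M ^+ 2 / c) ^+ 2).
  by rewrite ler_wpM2l// lerD2l.
apply: le_trans uFM.
have lo := mulF_ge F1 Fnd F_growth LK u0.
have Ku2 : 0 <= K * u ^+ 2 by rewrite mulr_ge0 ?sqr_ge0.
have hi : u * F u <= K * (1 + u ^+ 2).
  have [u1|/ltW u1] := leP 1 u.
    have := F_growth ltr01 u1; rewrite F1 divr1 add0r.
    by move=> /(ler_wpM2l u0); have := mulr_ge0 K0 u0; lra.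
  move: u0; rewrite le_eqVlt => /predU1P[<-|u0].
    by rewrite mul0r mulr_ge0// addr_ge0// sqr_ge0.
  apply: (@le_trans _ _ 0); last by rewrite mulr_ge0// addr_ge0// sqr_ge0.
  rewrite mulr_ge0_le0 ?(ltW u0)// -F1.
  by apply: Fnd => //; rewrite in_itv/= ?u0 ?ltr01.
rewrite ler_norml hi andbT; lra.
Qed.

Lemma rothaus_orlicz (f : T -> R) :
  measurable_fun [set: T] f -> bounded_fun f ->
  (orlicz_integral F mu f <= orlicz_integral F mu (centered mu f)
     + (200 * K)%:E * ('N[mu]_2%:E[EFin \o centered mu f]) ^+ 2)%E.
Proof.
move=> mf [M0 [_ /(_ (M0 + 1))]]; rewrite ltrDl ltr01 => /(_ isT) fM0.
pose M := M0 + 1; have fM x : `|f x| <= M by exact: fM0.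
pose a := (\int[mu]_x f x)%R; pose h := centered mu f.
have fE x : f x = a + h x by rewrite /h /centered -/a; ring.
have mh : measurable_fun setT h by exact: measurable_funB.
have hM x : `|h x| <= M + `|a| by rewrite (le_trans (ler_normB _ _))// lerD2r.
have ih : mu.-integrable setT (EFin \o h) by exact: bounded_integrable hM.
have if_ : mu.-integrable setT (EFin \o f) by exact: bounded_integrable fM.
have ic k : mu.-integrable setT (EFin \o (fun=> k : R)).
  exact: finite_measure_integrable_cst.
have ih2 : mu.-integrable setT (EFin \o (fun x => h x ^+ 2)).
  apply: (@bounded_integrable _ _ _ mu _ ((M + `|a|) ^+ 2)).
    exact: measurable_funX.
  move=> x; rewrite normrX lerXn2r ?nnegrE//.
  by rewrite (le_trans _ (hM x)).
have iZ k g : mu.-integrable setT (EFin \o g) ->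
    mu.-integrable setT (EFin \o (fun x => k * g x)).
  by move=> ig; exact: (@integrableZl _ _ _ mu _ measurableT k _ ig).
have iD g1 g2 : mu.-integrable setT (EFin \o g1) ->
    mu.-integrable setT (EFin \o g2) ->
    mu.-integrable setT (EFin \o (fun x => g1 x + g2 x)).
  by move=> ig1 ig2; exact: (integrableD measurableT ig1 ig2).
have ck k : (\int[mu]_x k)%R = k :> R.
  by rewrite Rintegral_cst//= probability_setT mulr1.
have h0 : (\int[mu]_x h x)%R = 0.
  by rewrite RintegralB// ck subrr.
pose v := (\int[mu]_x (h x ^+ 2))%R.
have v0 : 0 <= v by apply: Rintegral_ge0 => x _; exact: sqr_ge0.
have vE : (\int[mu]_x (h x ^+ 2)%:E = v%:E)%E.
  by rewrite fineK//; exact: integrable_fin_num ih2.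
rewrite Lnorm2_sqr vE -/h.
(* The pointwise inequality requires [v > 0]. *)
have [vz|vN0] := eqVneq v 0.
  have hz : {ae mu, forall x, h x = 0}.
    by apply: ae_eq0_of_sqr => //; rewrite vE vz.
  rewrite (orlicz_integral_ae_cst FC2 F1 mh hz).
  rewrite (@orlicz_integral_ae_cst _ _ _ _ mu f a)//.
    by rewrite vz mule0 adde0.
  by apply: filterS hz => x hx; rewrite fE hx addr0.
have {v0 vN0} v0 : 0 < v by rewrite lt_neqAle eq_sym vN0.
have m_eq : (\int[mu]_x (f x ^+ 2))%R = a ^+ 2 + v.
  rewrite (@eq_Rintegral _ _ _ mu _ (fun x => a ^+ 2 + (2 * a * h x + h x ^+ 2))); last first.
    by move=> x _; rewrite fE; ring.
  rewrite RintegralD//; last by apply: iD => //; exact: iZ.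
  by rewrite RintegralD//; [rewrite ck RintegralZl// h0 mulr0 add0r | exact: iZ].
have m0 : 0 < a ^+ 2 + v by rewrite ltr_wpDl ?sqr_ge0.
rewrite /orlicz_integral m_eq -/v.
have i1 := integrable_orlicz mf fM m0.
have i2 := integrable_orlicz mh hM v0.
rewrite -(fineK (integrable_fin_num measurableT i1)).
rewrite -(fineK (integrable_fin_num measurableT i2)).
rewrite -EFinM -EFinD lee_fin.
pose rhs x := h x ^+ 2 * F (h x ^+ 2 / v) +
  (100 * K * h x ^+ 2 + (100 * K * v + 2 * L * a * h x)).
have i3 : mu.-integrable setT (EFin \o (fun x => 100 * K * v + 2 * L * a * h x)).
  by apply: iD => //; exact: iZ.
have i4 : mu.-integrable setT
    (EFin \o (fun x => 100 * K * h x ^+ 2 + (100 * K * v + 2 * L * a * h x))).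
  by apply: iD => //; exact: iZ.
have int_rhs : (\int[mu]_x rhs x)%R =
    (\int[mu]_x (h x ^+ 2 * F (h x ^+ 2 / v)))%R + 200 * K * v.
  rewrite RintegralD// RintegralD//; last exact: iZ.
  rewrite RintegralZl// RintegralD//; last exact: iZ.
  rewrite ck RintegralZl// h0 -/v; ring.
have : (\int[mu]_x (f x ^+ 2 * F (f x ^+ 2 / (a ^+ 2 + v))) <= \int[mu]_x rhs x)%R.
  apply: le_Rintegral => //; first exact: iD.
  move=> x _; rewrite fE; have := pointwise_ineq F1 Fnd F_tangent F_growth LK a (h x) v0.
  rewrite /rhs; lra.
by rewrite int_rhs.
Qed.
End integration.

Theorem lemma3 (R : realType) (F : R -> R)
    (FC2 : C2_pos F) (F1 : F 1 = 0)
    (Fconcave : concave_pos F) (Fnd : nondecreasing_pos F)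
    (Finfty : F x @[x --> +oo] --> +oo)
    (uF'_bounded : exists K : R, forall u : R, 0 < u -> `|u * (F^`())%classic u| <= K) :
  exists CRot : R,
    forall (d : measure_display) (T : measurableType d)
      (mu : probability T R) (f : T -> R),
      measurable_fun [set: T] f -> bounded_fun f ->
      (orlicz_integral F mu f <=
         orlicz_integral F mu (centered mu f)
         + CRot%:E * ('N[mu]_2%:E[EFin \o centered mu f]) ^+ 2)%E.
Proof.
have [K FK] := uF'_bounded.
have dF u : 0 < u -> derivable F u 1 by move=> /FC2[].
exists (200 * K) => d T mu f; apply: (@rothaus_orlicz _ F K ((F^`())%classic 1)) => //.
- by move=> u u0; have := concave_le_tangent Fconcave ltr01 u0 (dF _ ltr01); rewrite F1 add0r.
- move=> u w u0 uw; apply: concave_growth => //; first exact: dF.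
  by rewrite (le_trans (ler_norm _))// FK.
- by have := FK 1 ltr01; rewrite mul1r.
Qed.
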